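(* Let $A\in\mathbb R^{m\times n}$ and $\beta\in\mathbb R^n$ be non-zero, and let $C=-A$, with $P$ and $Q'$ non-degenerate, so that $\mathcal N$ is a single path, directed from its unbounded edge $(v_s,\mathcal E_{v_s})$ to its unbounded edge $(v_e,\mathcal E_{v_e})$. Define $g:\mathcal N\to\mathbb R$ by $$g((y,\pi_1),(x,\lambda,\pi_2))=\beta^Ty+\lambda.$$ Then each term of $g$, namely $\beta^Ty$ and $\lambda$, monotonically increases on the directed path $\mathcal N$, and the function $g$ strictly increases on it.
   Context: Let $S_1=\{1,\dots,m\}$, $S_2=\{1,\dots,n\}$, $A=[a_{ij}]$. For a matrix $M$, $M_i$ is its $i$-th row and $M^j$ its $j$-th column. $P=\{(y,\pi_1)\in\mathbb R^{n+1}: A_iy-\pi_1\le0\ (i\in S_1);\ y_j\ge0\ (j\in S_2);\ \sum_j y_j=1\}$ (of dimension $n$). $Q'=\{(x,\lambda,\pi_2)\in\mathbb R^{m+2}: x_i\ge0\ (i\in S_1);\ -x^TA^j+\beta_j\lambda-\pi_2\le0\ (j\in S_2);\ \sum_i x_i=1\}$ (of dimension $m+1$). In both polyhedra the inequalities indexed by $i\in S_1$ are numbered $1,\dots,m$ and those indexed by $j\in S_2$ are numbered $m+1,\dots,m+n$. The label $L(v)$ of a point is the set of numbers of inequalities tight at it. $\mathcal N=\{(v,w)\in P\times Q': L(v)\cup L(w)=\{1,\dots,m+n\}\}$; for $v\in P$, $\mathcal E_v=\{w\in Q':(v,w)\in\mathcal N\}$, and $(v,\mathcal E_v)$ denotes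 $\{v\}\times\mathcal E_v$. Let $j_s,j_e\in S_2$ be indices with $\beta_{j_s}=\min_j\beta_j$ and $\beta_{j_e}=\max_j\beta_j$. Non-degeneracy: every point in the relative interior of a $d$-dimensional face of $P$ (resp. $Q'$) has exactly $n-d$ (resp. $m+1-d$) tight inequalities. Non-degeneracy of $Q'$ is understood to entail $j_s\ne j_e$. Let $i_s=\arg\max_i a_{ij_s}$, $i_e=\arg\max_i a_{ij_e}$, $v_s=(e_{j_s},a_{i_sj_s})$, $v_e=(e_{j_e},a_{i_ej_e})$ (vertices of $P$, $e_j$ the $j$-th unit vector of $\mathbb R^n$). In this setting $\mathcal N$ is a single path (homeomorphic to $\mathbb R$) on the $1$-skeleton of $P\times Q'$, whose two unbounded end edges are $(v_s,\mathcal E_{v_s})$ and $(v_e,\mathcal E_{v_e})$. ''Monotonically increases'' is meant in the weak sense ($\beta^Ty$ and $\lambda$ may each be constant on some edges). *)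

(* Defs.v *)
From HB Require Import structures.
From mathcomp Require Import all_boot all_order all_algebra.
From mathcomp Require Import all_classical all_reals all_analysis.

Set Implicit Arguments.
Unset Strict Implicit.
Unset Printing Implicit Defensive.

Import Order.TTheory GRing.Theory Num.Theory.
Import numFieldNormedType.Exports.

Local Open Scope classical_set_scope.
Local Open Scope ring_scope.

Definition affine_hull (R : realType) (N : nat) (F : set 'cV[R]_N) :
    set 'cV[R]_N :=
  [set p | exists (k : nat) (c : 'I_k -> R) (q : 'I_k -> 'cV[R]_N),
    [/\ forall i, F (q i), \sum_(i < k) c i = 1
      & p = \sum_(i < k) c i *: q i]].

(* The affine hull of F is a translate of a linear subspace of dimension d; the
   empty set has no dimension. *)
Definition has_dim (R : realType) (N : nat) (F : set 'cV[R]_N) (d : nat) :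
    Prop :=
  exists (p : 'cV[R]_N) (U : {vspace 'cV[R]_N}),
    [/\ F p, \dim U = d & forall q, affine_hull F q <-> q - p \in U].

(* Interior of F in the subspace topology of its affine hull. *)
Definition relative_interior (R : realType) (N : nat) (F : set 'cV[R]_N) :
    set 'cV[R]_N :=
  [set p | F p /\ within (affine_hull F) (nbhs p) F].

(* X is the solution set of finitely many linear equations and of inequalities
   numbered by 'I_k, and L p is the set of the inequalities tight at p. A face
   of X is a nonempty set obtained by turning some of the inequalities into
   equations (none of them, for X itself). *)
Definition is_face (R : realType) (N k : nat) (X : set 'cV[R]_N)
    (L : 'cV[R]_N -> {set 'I_k}) (F : set 'cV[R]_N) : Prop :=
  F !=set0 /\ exists I : {set 'I_k}, F = X `&` [set p | I \subset L p].

(* D is the dimension of X; the addition avoids the truncation of D - d. *)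
Definition nondegenerate_polyhedron (R : realType) (N k : nat) (X : set 'cV[R]_N)
    (L : 'cV[R]_N -> {set 'I_k}) (D : nat) : Prop :=
  forall (F : set 'cV[R]_N) (d : nat) (p : 'cV[R]_N),
    is_face X L F -> has_dim F d -> relative_interior F p ->
    (#|L p| + d = D)%N.

(* Coordinates of (y, pi1) in R^(n+1) and of (x, lambda, pi2) in R^(m+2). *)
Definition y_of (R : realType) (n : nat) (v : 'cV[R]_(n + 1)) : 'cV[R]_n :=
  usubmx v.
Definition pi1_of (R : realType) (n : nat) (v : 'cV[R]_(n + 1)) : R :=
  dsubmx v ord0 ord0.
Definition x_of (R : realType) (m : nat) (w : 'cV[R]_(m + 2)) : 'cV[R]_m :=
  usubmx w.
Definition lambda_of (R : realType) (m : nat) (w : 'cV[R]_(m + 2)) : R :=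
  dsubmx w ord0 ord0.
Definition pi2_of (R : realType) (m : nat) (w : 'cV[R]_(m + 2)) : R :=
  dsubmx w ord_max ord0.

Definition polyhedronP (R : realType) (m n : nat) (A : 'M[R]_(m, n)) :
    set 'cV[R]_(n + 1) :=
  [set v | [/\ forall i : 'I_m, (A *m y_of v) i ord0 - pi1_of v <= 0,
               forall j : 'I_n, 0 <= y_of v j ord0
             & \sum_(j < n) y_of v j ord0 = 1]].

Definition polyhedronQ' (R : realType) (m n : nat) (C : 'M[R]_(m, n))
    (beta : 'cV[R]_n) : set 'cV[R]_(m + 2) :=
  [set w | [/\ forall i : 'I_m, 0 <= x_of w i ord0,
               forall j : 'I_n, ((x_of w)^T *m C) ord0 j
                 + beta j ord0 * lambda_of w - pi2_of w <= 0
             & \sum_(i < m) x_of w i ord0 = 1]].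

(* Inequalities indexed by i : 'I_m and j : 'I_n have the (0-based) numbers
   lshift n i = i and rshift m j = m + j. *)
Definition labelsP (R : realType) (m n : nat) (A : 'M[R]_(m, n))
    (v : 'cV[R]_(n + 1)) : {set 'I_(m + n)} :=
  [set k : 'I_(m + n) | match fintype.split k with
           | inl i => (A *m y_of v) i ord0 - pi1_of v == 0
           | inr j => y_of v j ord0 == 0
           end]%SET.

Definition labelsQ' (R : realType) (m n : nat) (C : 'M[R]_(m, n))
    (beta : 'cV[R]_n) (w : 'cV[R]_(m + 2)) : {set 'I_(m + n)} :=
  [set k : 'I_(m + n) | match fintype.split k with
           | inl i => x_of w i ord0 == 0
           | inr j => ((x_of w)^T *m C) ord0 j
                        + beta j ord0 * lambda_of w - pi2_of w == 0
           end]%SET.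

Definition calN (R : realType) (m n : nat) (A C : 'M[R]_(m, n))
    (beta : 'cV[R]_n) : set ('cV[R]_(n + 1) * 'cV[R]_(m + 2)) :=
  [set vw | [/\ polyhedronP A vw.1, polyhedronQ' C beta vw.2
              & labelsP A vw.1 :|: labelsQ' C beta vw.2
                = [set: 'I_(m + n)]%SET]].

Definition calE (R : realType) (m n : nat) (A C : 'M[R]_(m, n))
    (beta : 'cV[R]_n) (v : 'cV[R]_(n + 1)) : set 'cV[R]_(m + 2) :=
  [set w | calN A C beta (v, w)].

(* The point (e_j, a_ij) of R^(n+1). *)
Definition pure_point (R : realType) (m n : nat) (A : 'M[R]_(m, n))
    (i : 'I_m) (j : 'I_n) : 'cV[R]_(n + 1) :=
  col_mx (delta_mx j ord0) (A i j)%:M.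

Definition homeomorphism_onto (T U : topologicalType) (f : T -> U)
    (B : set U) : Prop :=
  [/\ continuous f, range f = B
    & exists h : U -> T, cancel f h /\ {within B, continuous h}].

(* gamma exhibits X as a path homeomorphic to the real line, directed from its
   end S to its end E. *)
Definition directed_path (R : realType) (U : topologicalType) (X S E : set U)
    (gamma : R -> U) : Prop :=
  [/\ homeomorphism_onto gamma X,
      \forall t \near -oo, S (gamma t)
    & \forall t \near +oo, E (gamma t)].

Definition beta_y_at (R : realType) (m n : nat) (beta : 'cV[R]_n)
    (p : 'cV[R]_(n + 1) * 'cV[R]_(m + 2)) : R :=
  (beta^T *m y_of p.1) ord0 ord0.

Definition lambda_at (R : realType) (m n : nat)
    (p : 'cV[R]_(n + 1) * 'cV[R]_(m + 2)) : R :=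
  lambda_of p.2.

Definition g_sum (R : realType) (m n : nat) (beta : 'cV[R]_n)
    (p : 'cV[R]_(n + 1) * 'cV[R]_(m + 2)) : R :=
  beta_y_at beta p + lambda_at p.

(* Main.v *)
Require Import Defs.
From HB Require Import structures.
From mathcomp Require Import all_boot all_order all_algebra.
From mathcomp Require Import all_classical all_reals all_analysis.
From mathcomp Require Import ring lra zify.

Set Implicit Arguments.
Unset Strict Implicit.
Unset Printing Implicit Defensive.

Import Order.TTheory GRing.Theory Num.Theory.
Import numFieldNormedType.Exports.

Local Open Scope classical_set_scope.
Local Open Scope ring_scope.

(* For v = (y, pi1) in P and w = (x, lambda, pi2) in Q', the number
   pi1 + pi2 - lambda * beta^T y is the sum of the complementarity products
   x_i * slack_i(v) and y_j * slack_j(w): it is nonnegative, and it vanishes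
   exactly on N. Applying this to the four pairs made of two points (v, w),
   (v', w') of N yields (lambda' - lambda) (beta^T y' - beta^T y) >= 0, with
   equality iff (v, w') and (v', w) are in N as well. Since non-degeneracy makes
   the tight constraints linearly independent, v is then determined by w and
   beta^T y, and w by v and lambda. Hence g is injective on N, so that it is
   strictly monotone along the path, and it increases because
   beta_{js} < beta_{je}; the two terms of g are comonotone, so both
   increase. *)

(** * Non-degeneracy as linear independence of tight constraints *)

(** The image of [M] lies in the kernel of [u], a proper subspace of the space of columns of height
    [r], so the rank of [M] is below [r]; rank-nullity gives the bound. *)
Lemma dim_lker_mulmx_gt (F : fieldType) (r N : nat) (M : 'M[F]_(r, N))
    (u : 'rV[F]_r) :
  u != 0 -> u *m M = 0 ->
  (N < \dim (lker (linfun (mulmx M : 'cV[F]_N -> 'cV[F]_r))) + r)%N.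
Proof.
move=> u0 uM.
set f := linfun (mulmx M : 'cV[F]_N -> 'cV[F]_r).
set g := linfun (mulmx u : 'cV[F]_r -> 'cV[F]_1).
have dimf := limg_ker_dim f fullv.
have dimg := limg_ker_dim g fullv.
rewrite capfv dimvf dim_matrix mulr1 in dimf.
rewrite capfv dimvf dim_matrix mulr1 in dimg.
have fg : (\dim (limg f) <= \dim (lker g))%N.
  apply/dimvS/subvP => q /memv_imgP[z _ ->].
  by rewrite memv_ker !lfunE /= mulmxA uM mul0mx.
have g0 : (0 < \dim (limg g))%N.
  rewrite lt0n dimv_eq0 -lkerE; apply: contra u0 => /subvP h.
  apply/eqP/rowP => i.
  have := h (delta_mx i 0) (memvf _).
  rewrite memv_ker lfunE /= -colE => /eqP/matrixP/(_ 0 0).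
  by rewrite !mxE.
lia.
Qed.

Lemma mulmx_coord_continuous (R : realType) (r N : nat) (G : 'M[R]_(r, N))
    (i : 'I_r) : continuous (fun q : 'cV[R]_N => (G *m q) i 0).
Proof.
move=> q; under eq_fun do rewrite mxE.
apply: (@cvg_big _ _ _ _ _ _ _ (nbhs q)) => [|j _]; first exact: add_continuous.
apply: cvgM; first exact: cvg_cst.
exact: coord_continuous.
Qed.

(* The minimal face of p has dimension N - rank of its tight rows and of E, so
   non-degeneracy says that this rank is #|L p| + 1. *)
Lemma nondegenerate_tight_independent (R : realType) (N k D : nat)
    (X : set 'cV[R]_N) (L : 'cV[R]_N -> {set 'I_k})
    (G : 'M[R]_(k, N)) (E : 'rV[R]_N) (e : R) (p : 'cV[R]_N)
    (c : 'rV[R]_k) (mu : R) :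
  (forall q, X q <-> (forall i, (G *m q) i 0 <= 0) /\ (E *m q) 0 0 = e) ->
  (forall q i, (i \in L q) = ((G *m q) i 0 == 0)) ->
  nondegenerate_polyhedron X L D -> N = D.+1 -> X p ->
  (forall i, i \notin L p -> c 0 i = 0) -> c *m G + mu *: E = 0 ->
  c = 0 /\ mu = 0.
Proof.
move=> XE LE nd ND Xp cL cG.
pose h : 'I_#|L p| -> 'I_k := enum_val.
pose M := col_mx (rowsub h G) E.
(* The direction space of the smallest face containing [p]; that face is [F] below. *)
pose U := lker (linfun (mulmx M : 'cV[R]_N -> 'cV[R]_(#|L p| + 1))).
have UE d : d \in U <->
    (forall i, i \in L p -> (G *m d) i 0 = 0) /\ (E *m d) 0 0 = 0.
  rewrite memv_ker lfunE /= mul_col_mx -[0]vsubmxK linear0 linear0.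
  split.
    move=> /eqP/eq_col_mx[hG hE]; split; last by rewrite hE mxE.
    move=> i iL; have := congr1 (fun B : 'cV_ _ => B (enum_rank_in iL i) 0) hG.
    rewrite mxE [RHS]mxE => <-; rewrite mxE; apply: eq_bigr => j _.
    by rewrite mxE /h enum_rankK_in.
  move=> [hG hE]; apply/eqP; congr col_mx; apply/matrixP => i j.
    rewrite !ord1 [RHS]mxE -(hG (h i) (enum_valP i)) !mxE.
    by apply: eq_bigr => l _; rewrite mxE.
  by rewrite !ord1 hE mxE.
pose F := X `&` [set q | L p \subset L q].
have FE q : F q <-> [/\ forall i, (G *m q) i 0 <= 0, q - p \in U
    & (E *m q) 0 0 = e].
  have [Gp Ep] := (XE p).1 Xp.
  split.
    move=> [/XE[Gq Eq] /fintype.subsetP Lpq]; split=> //; apply/UE; split.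
      move=> i iL; rewrite mulmxBr !mxE.
      have := Lpq _ iL; rewrite LE => /eqP; rewrite mxE => ->.
      by move: iL; rewrite LE => /eqP; rewrite mxE => ->; rewrite subrr.
    by rewrite mulmxBr mxE [X in _ + X]mxE Eq Ep subrr.
  move=> [Gq /UE[qU _] Eq]; split; first by apply/XE.
  apply/fintype.subsetP => i iL; have := qU i iL.
  rewrite mulmxBr mxE [X in _ + X]mxE LE.
  by move: iL; rewrite LE => /eqP ->; rewrite subr0 => ->.
have Fp : F p by split => /=.
have affU q : affine_hull F q -> q - p \in U.
  move=> [l [a [s [Fs a1 ->]]]].
  have -> : \sum_(i < l) a i *: s i - p = \sum_(i < l) a i *: (s i - p).
    under [RHS]eq_bigr do rewrite scalerBr.
    by rewrite sumrB -scaler_suml a1 scale1r.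
  by apply: memv_suml => i _; apply: memvZ; have [] := (FE _).1 (Fs i).
(* Constraints slack at [p] stay slack nearby, so [F] fills [p + U] around [p]. Both the dimension
   of [F] and the relative interiority of [p] rest on this. *)
have nearF : \forall q \near p, q - p \in U -> F q.
  have slack : \forall q \near p, forall i, i \notin L p -> (G *m q) i 0 < 0.
    apply: (@filter_forall _ _
      (fun i q => i \notin L p -> (G *m q) i 0 < 0) (nbhs p) _) => i.
    case: (boolP (i \in L p)) => iL.
      by apply: nearW.
    have : (G *m p) i 0 < 0.
      by rewrite lt_neqAle -LE iL; have [Gp _] := (XE p).1 Xp; apply: Gp.
    move=> Gp0; near=> q => _; near: q.
    exact: (cvgr_lt _ (@mulmx_coord_continuous R k N G i p)).
  near=> q => qU; apply/FE.
  have [Gp Ep] := (XE p).1 Xp; have [qG qE] := (UE _).1 qU.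
  split => // [i|].
    case: (boolP (i \in L p)) => iL.
      have := qG i iL; rewrite mulmxBr mxE [X in _ + X]mxE => /eqP.
      by rewrite subr_eq0 => /eqP ->.
    apply: ltW; move: i iL; near: q; exact: slack.
  by have := qE; rewrite mulmxBr mxE [X in _ + X]mxE Ep => /eqP;
    rewrite subr_eq0 => /eqP.
have Uaff q : q - p \in U -> affine_hull F q.
  move=> qU.
  have lim : (fun t : R => p + t *: (q - p)) t @[t --> 0^'+] --> p.
    rewrite -[X in _ --> X]addr0 -(scale0r (q - p)).
    apply: cvgD; first exact: cvg_cst.
    by apply: cvgZr_tmp; exact: cvg_at_right_filter.
  have near0 : \forall t \near 0^'+, F (p + t *: (q - p)).
    near=> t.
    have : p + t *: (q - p) - p \in U by rewrite addrC addKr memvZ.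
    by near: t; exact: (lim _ nearF).
  have [t [t0 Ft]] : exists t : R, 0 < t /\ F (p + t *: (q - p)).
    near (0 : R)^'+ => t; exists t; split; first by [].
    by near: t; exact: near0.
  (* For small [t > 0] the point [p + t (q - p)] lies in [F], and [q] is its affine combination with
     [p], with weights [1/t] and [1 - 1/t]. *)
  exists 2%N, (fun i => if i == 0 then 1 - t^-1 else t^-1),
    (fun i => if i == 0 then p else p + t *: (q - p)).
  split=> [i||]; first by case: ifP.
    by rewrite !big_ord_recl big_ord0 /= addr0 subrK.
  rewrite !big_ord_recl big_ord0 /= addr0 scalerDr scalerA mulVf ?gt_eqF//.
  by rewrite scale1r addrA -scalerDl subrK scale1r addrC subrK.
have dimF : has_dim F (\dim U).
  by exists p, U; split=> // q; split; [exact: affU | exact: Uaff].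
have ri : relative_interior F p.
  split=> //; rewrite /within /=; near=> q => /affU; near: q; exact: nearF.
have faceF : is_face X L F by split; [exists p | exists (L p)].
have Ldim := nd _ _ _ faceF dimF ri.
pose u : 'rV[R]_(#|L p| + 1) := row_mx (\row_j c 0 (h j)) (const_mx mu).
have uM : u *m M = 0.
  rewrite mul_row_col -cG; congr (_ + _); last first.
    by apply/rowP => j; rewrite !mxE big_ord1 !mxE.
  apply/rowP => j; rewrite !mxE (bigID (mem (L p))) /=.
  rewrite [X in _ = _ + X]big1 ?addr0.
    rewrite [RHS](big_enum_val (fun i => c 0 i * G i j)) /=.
    by apply: eq_bigr => i _; rewrite !mxE.
  by move=> i /cL ->; rewrite mul0r.
(* A nonzero [u] would give [N < dim U + #|L p| + 1], whose right side is [D + 1 = N] by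
   non-degeneracy. *)
have u0 : u = 0.
  apply/eqP/negPn/negP => /dim_lker_mulmx_gt/(_ uM).
  rewrite -/U; lia.
split.
  apply/rowP => i; rewrite [RHS]mxE.
  case: (boolP (i \in L p)) => iL; last exact: cL.
  have := congr1 (fun B : 'rV_ _ => B 0 (lshift 1 (enum_rank_in iL i))) u0.
  by rewrite row_mxEl !mxE /h enum_rankK_in.
have := congr1 (fun B : 'rV_ _ => B 0 (rshift #|L p| 0)) u0.
by rewrite row_mxEr !mxE.
Unshelve. all: by end_near.
Qed.

(** * Complementarity and comonotonicity on [calN] *)

Lemma labelsP_lshift (R : realType) (m n : nat) (A : 'M[R]_(m, n)) v i :
  (lshift n i \in labelsP A v) = ((A *m y_of v) i ord0 - pi1_of v == 0).
Proof. by rewrite inE -[lshift n i]/(unsplit (inl i)) unsplitK. Qed.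

Lemma labelsP_rshift (R : realType) (m n : nat) (A : 'M[R]_(m, n)) v j :
  (rshift m j \in labelsP A v) = (y_of v j ord0 == 0).
Proof. by rewrite inE -[rshift m j]/(unsplit (inr j)) unsplitK. Qed.

Lemma labelsQ'_lshift (R : realType) (m n : nat) (C : 'M[R]_(m, n)) beta w i :
  (lshift n i \in labelsQ' C beta w) = (x_of w i ord0 == 0).
Proof. by rewrite inE -[lshift n i]/(unsplit (inl i)) unsplitK. Qed.

Lemma labelsQ'_rshift (R : realType) (m n : nat) (C : 'M[R]_(m, n)) beta w j :
  (rshift m j \in labelsQ' C beta w) =
  (((x_of w)^T *m C) ord0 j + beta j ord0 * lambda_of w - pi2_of w == 0).
Proof. by rewrite inE -[rshift m j]/(unsplit (inr j)) unsplitK. Qed.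

Definition labelsE :=
  (labelsP_lshift, labelsP_rshift, labelsQ'_lshift, labelsQ'_rshift).

Lemma beta_y_atE (R : realType) (m n : nat) (beta : 'cV[R]_n)
    (p : 'cV[R]_(n + 1) * 'cV[R]_(m + 2)) :
  beta_y_at beta p = \sum_j beta j ord0 * y_of p.1 j ord0.
Proof.
by rewrite /beta_y_at mxE; apply: eq_bigr => j _; rewrite [_^T _ _]mxE.
Qed.

Lemma calNE (R : realType) (m n : nat) (A C : 'M[R]_(m, n)) beta v w :
  calN A C beta (v, w) <->
  [/\ polyhedronP A v, polyhedronQ' C beta w,
      forall i, (x_of w i ord0 == 0)
        || ((A *m y_of v) i ord0 - pi1_of v == 0)
    & forall j, (y_of v j ord0 == 0)
        || (((x_of w)^T *m C) ord0 j + beta j ord0 * lambda_of w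
              - pi2_of w == 0)].
Proof.
split=> [[/= Pv Qw /setP L]|[Pv Qw Li Lj]]; split=> //.
- by move=> i; have := L (lshift n i); rewrite inE !labelsE inE orbC.
- by move=> j; have := L (rshift m j); rewrite inE !labelsE inE.
- apply/setP => k; rewrite [RHS]inE inE.
  case: (split_ordP k) => i ->; rewrite !labelsE; last exact: Lj.
  by rewrite orbC; exact: Li.
Qed.

(** Weak duality with complementary slackness as its equality case; since [C = -A], the bilinear
    terms [x^T A y] of the two families of products cancel. *)
Lemma calN_gap (R : realType) (m n : nat) (A : 'M[R]_(m, n)) beta v w :
  polyhedronP A v -> polyhedronQ' (- A) beta w ->
  lambda_of w * beta_y_at beta (v, w) <= pi1_of v + pi2_of w
    ?= iff `[< calN A (- A) beta (v, w) >].
Proof.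
move=> Pv Qw; have [Ay y0 y1] := Pv; have [x0 xA x1] := Qw.
pose S i := x_of w i ord0 * (pi1_of v - (A *m y_of v) i ord0).
pose T j := y_of v j ord0 * (pi2_of w
  - (((x_of w)^T *m - A) ord0 j + beta j ord0 * lambda_of w)).
have S0 i : 0 <= S i by rewrite mulr_ge0// subr_ge0 -subr_le0.
have T0 j : 0 <= T j by rewrite mulr_ge0// subr_ge0 -subr_le0.
have gap : pi1_of v + pi2_of w - lambda_of w * beta_y_at beta (v, w) =
    \sum_i S i + \sum_j T j.
  (* The normalizations of [x] here and of [y] in [TE] spread [pi1] and [pi2] over the summands. *)
  have SE : \sum_i S i = pi1_of v - ((x_of w)^T *m A *m y_of v) 0 0.
    rewrite -mulmxA mxE -[pi1_of v]mul1r -x1 mulr_suml -sumrB.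
    by apply: eq_bigr => i _; rewrite /S mulrBr [_^T _ _]mxE.
  have TE : \sum_j T j = pi2_of w + ((x_of w)^T *m A *m y_of v) 0 0
      - lambda_of w * beta_y_at beta (v, w).
    rewrite mxE -[pi2_of w]mul1r -y1 mulr_suml -big_split /= /beta_y_at.
    rewrite mxE mulr_sumr -sumrB; apply: eq_bigr => j _.
    by rewrite /T mulmxN !mxE; ring.
  by rewrite SE TE; ring.
have S00 : 0 <= \sum_i S i by apply: sumr_ge0.
have T00 : 0 <= \sum_j T j by apply: sumr_ge0.
apply/leifP; case: asboolP => [/calNE[_ _ Li Lj]|nN].
  rewrite eq_sym -subr_eq0 gap; apply/eqP.
  rewrite !big1 ?addr0// => [j|i] _; apply/eqP; rewrite mulf_eq0.
    by have /orP[->//|] := Lj j; rewrite -opprB oppr_eq0 => ->; rewrite orbT.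
  by have /orP[->//|] := Li i; rewrite -opprB oppr_eq0 => ->; rewrite orbT.
rewrite -subr_gt0 gap lt_neqAle addr_ge0// andbT eq_sym.
(* A vanishing sum of nonnegative products makes every product vanish, which is membership in
   [calN]. *)
apply/negP; rewrite paddr_eq0// !psumr_eq0// => /andP[/allP/= SS /allP/= TT].
apply: nN; apply/calNE; split=> // [i|j].
  have := SS i (mem_index_enum _).
  by rewrite mulf_eq0 -[in X in _ || X]opprB oppr_eq0.
have := TT j (mem_index_enum _).
by rewrite mulf_eq0 -[in X in _ || X]opprB oppr_eq0.
Qed.

Lemma calN_comonotone (R : realType) (m n : nat) (A : 'M[R]_(m, n)) beta
    (p q : 'cV[R]_(n + 1) * 'cV[R]_(m + 2)) :
  calN A (- A) beta p -> calN A (- A) beta q ->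
  0 <= (lambda_at q - lambda_at p) * (beta_y_at beta q - beta_y_at beta p)
    ?= iff `[< calN A (- A) beta (p.1, q.2) /\ calN A (- A) beta (q.1, p.2) >].
Proof.
case: p q => [v w] [v' w'] N1 N2.
have [Pv Qw _] := N1; have [Pv' Qw' _] := N2.
have [_] := calN_gap Pv Qw; rewrite (asboolT N1) => /eqP g1.
have [_] := calN_gap Pv' Qw'; rewrite (asboolT N2) => /eqP g2.
(* The gap inequalities of the two crossed pairs are added; the equalities [g1] and [g2] then
   eliminate [pi1] and [pi2]. *)
have := leifD (calN_gap Pv Qw') (calN_gap Pv' Qw).
rewrite /lambda_at /= /beta_y_at /= in g1 g2 *.
have -> : (lambda_of w' - lambda_of w) *
    ((beta^T *m y_of v') 0 0 - (beta^T *m y_of v) 0 0) =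
    (pi1_of v + pi2_of w' + (pi1_of v' + pi2_of w)) -
    (lambda_of w' * (beta^T *m y_of v) 0 0 +
     lambda_of w * (beta^T *m y_of v') 0 0) by lra.
move=> [le eqC]; split; first by rewrite subr_ge0.
by rewrite eq_sym subr_eq0 eq_sym eqC asbool_and.
Qed.

(** * Each component of a point of [calN] is determined by the other and one scalar *)

(* A difference v' - v with the same value of beta^T y gives coefficients of a
   linear dependence between the constraints of Q' tight at w. *)
Lemma calN_fst_inj (R : realType) (m n : nat) (A : 'M[R]_(m, n)) beta v v' w :
  nondegenerate_polyhedron (polyhedronQ' (- A) beta) (labelsQ' (- A) beta)
    m.+1 ->
  calN A (- A) beta (v, w) -> calN A (- A) beta (v', w) ->
  beta_y_at beta (v, w) = beta_y_at beta (v', w) -> v = v'.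
Proof.
move=> nd /calNE[[Ay y0 y1] Qw Li Lj] /calNE[[Ay' y0' y1'] _ Li' Lj'] hb.
(* [Q'] is written as [G u <= 0], [E u = 1]; the last two columns of [G] belong to [lambda] and
   [pi2]. *)
pose G : 'M[R]_(m + n, m + 2) := block_mx (- 1%:M) 0 (- A)^T
  (\matrix_(j < n, k < 2) if k == ord0 then beta j ord0 else -1).
pose E : 'rV[R]_(m + 2) := row_mx (const_mx 1) 0.
pose z := y_of v' - y_of v.
pose d := pi1_of v' - pi1_of v.
(* The change from [v] to [v'] of the slacks [pi1 - A_i y] and [y_j]. *)
pose c : 'rV[R]_(m + n) := row_mx (const_mx d - (A *m z)^T) z^T.
have Gl u i : (G *m u) (lshift n i) 0 = - x_of u i ord0.
  rewrite -[u in LHS]vsubmxK mul_block_col mul0mx addr0 mulNmx mul1mx.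
  by rewrite col_mxEu mxE.
have Gr u j : (G *m u) (rshift m j) 0 =
    ((x_of u)^T *m - A) ord0 j + beta j ord0 * lambda_of u - pi2_of u.
  rewrite -[u in LHS]vsubmxK mul_block_col col_mxEd mxE -addrA.
  congr (_ + _); first by rewrite -[usubmx u]trmxK -trmx_mul mxE.
  rewrite /lambda_of /pi2_of mxE !big_ord_recl big_ord0 !mxE /= addr0 mulN1r.
  by congr (_ - u _ _); apply: val_inj.
have Eu u : (E *m u) 0 0 = \sum_(i < m) x_of u i ord0.
  rewrite -[u in LHS]vsubmxK mul_row_col mul0mx addr0 mxE.
  by apply: eq_bigr => i _; rewrite mxE mul1r.
(* Where [w] is slack, complementarity makes both [v] and [v'] tight, so the change is zero. *)
have cL : forall i, i \notin labelsQ' (- A) beta w -> c 0 i = 0.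
  move=> k; case: (split_ordP k) => i ->; rewrite !labelsE => nL.
    have := Li i; have := Li' i; rewrite (negPf nL) /= => /eqP e' /eqP e.
    have Az : (A *m z) i 0 = (A *m y_of v') i 0 - (A *m y_of v) i 0.
      by rewrite mulmxBr mxE [X in _ + X]mxE.
    have -> : c 0 (lshift n i) = d - (A *m z) i 0.
      by rewrite row_mxEl mxE [X in _ + X]mxE [_^T _ _]mxE [const_mx _ _ _]mxE.
    by rewrite Az /d; lra.
  have := Lj i; have := Lj' i; rewrite (negPf nL) !orbF => /eqP e' /eqP e.
  by rewrite row_mxEr mxE mxE e' [X in _ + X]mxE e subrr.
(* In the [x] columns everything cancels against [d E]; the [lambda] column vanishes by [hb], and
   the [pi2] column because [y] and [y'] both sum to 1. *)
have cG : c *m G + d *: E = 0.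
  rewrite mul_row_block scale_row_mx add_row_mx scaler0 addr0 mulmx0 add0r.
  rewrite -[0]hsubmxK linear0 linear0; congr row_mx.
    rewrite mulmxN mulmx1 -trmx_mul mulNmx linearN /=.
    by apply/rowP => i; rewrite !mxE; ring.
  apply/rowP => k; rewrite [LHS]mxE [RHS]mxE.
  have zb : \sum_j z j 0 * beta j 0 = 0.
    rewrite -[RHS](subrr (beta_y_at beta (v', w))) -[X in _ - X]hb.
    rewrite !beta_y_atE -sumrB; apply: eq_bigr => j _.
    by rewrite /z mxE [X in _ + X]mxE; ring.
  have z1 : \sum_j z j 0 = 0.
    rewrite -[RHS](subrr 1) -[X in X - _]y1' -[X in _ - X]y1 -sumrB.
    by apply: eq_bigr => j _; rewrite /z mxE [X in _ + X]mxE.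
  case: (eqVneq k ord0) => [->|k0].
    rewrite -[RHS]zb; apply: eq_bigr => j _.
    by rewrite [z^T _ _]mxE [X in _ * X]mxE eqxx.
  rewrite -[RHS]oppr0 -[in RHS]z1 -sumrN; apply: eq_bigr => j _.
  by rewrite [z^T _ _]mxE [X in _ * X]mxE (negPf k0) mulrN1.
have QE u : polyhedronQ' (- A) beta u <->
    (forall k, (G *m u) k 0 <= 0) /\ (E *m u) 0 0 = 1.
  rewrite Eu; split.
    move=> [u0 uA u1]; split=> // k; case: (split_ordP k) => i ->.
      by rewrite Gl oppr_le0.
    by rewrite Gr.
  move=> [Gu Eu1]; split=> // i; first by rewrite -oppr_le0 -Gl.
  by rewrite -Gr.
have LE u k : (k \in labelsQ' (- A) beta u) = ((G *m u) k 0 == 0).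
  case: (split_ordP k) => i ->; rewrite !labelsE; last by rewrite Gr.
  by rewrite Gl oppr_eq0.
have [c0 d0] := nondegenerate_tight_independent QE LE nd (addn2 m) Qw cL cG.
have z0 : z = 0.
  apply/matrixP => i j; rewrite ord1 [RHS]mxE.
  have := congr1 (fun B : 'rV_ _ => B 0 (rshift m i)) c0.
  by rewrite row_mxEr !mxE.
rewrite -[v]vsubmxK -[v']vsubmxK; congr col_mx.
  by apply/eqP; rewrite eq_sym -subr_eq0; apply/eqP.
apply/matrixP => i j; rewrite !ord1; apply/eqP.
by rewrite eq_sym -subr_eq0; apply/eqP.
Qed.

(* Dually, w' - w with the same lambda gives a dependence between the
   constraints of P tight at v. *)
Lemma calN_snd_inj (R : realType) (m n : nat) (A : 'M[R]_(m, n)) beta v w w' :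
  nondegenerate_polyhedron (polyhedronP A) (labelsP A) n ->
  calN A (- A) beta (v, w) -> calN A (- A) beta (v, w') ->
  lambda_of w = lambda_of w' -> w = w'.
Proof.
move=> nd /calNE[Pv [x0 xA x1] Li Lj] /calNE[_ [x0' xA' x1'] Li' Lj'] hl.
pose G : 'M[R]_(m + n, n + 1) := block_mx A (const_mx (-1)) (- 1%:M) 0.
pose E : 'rV[R]_(n + 1) := row_mx (const_mx 1) 0.
pose z := x_of w' - x_of w.
pose d := pi2_of w' - pi2_of w.
(* The change from [w] to [w'] of the slacks of [Q']; no [beta] term appears because [lambda] is the
   same. *)
pose c : 'rV[R]_(m + n) := row_mx z^T (z^T *m A + const_mx d).
have Gl u i : (G *m u) (lshift n i) 0 = (A *m y_of u) i ord0 - pi1_of u.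
  rewrite -[u in LHS]vsubmxK mul_block_col col_mxEu mxE; congr (_ + _).
  by rewrite mxE big_ord1 mxE mulN1r.
have Gr u j : (G *m u) (rshift m j) 0 = - y_of u j ord0.
  rewrite -[u in LHS]vsubmxK mul_block_col mul0mx addr0 mulNmx mul1mx.
  by rewrite col_mxEd mxE.
have Eu u : (E *m u) 0 0 = \sum_(j < n) y_of u j ord0.
  rewrite -[u in LHS]vsubmxK mul_row_col mul0mx addr0 mxE.
  by apply: eq_bigr => i _; rewrite mxE mul1r.
have cL : forall k, k \notin labelsP A v -> c 0 k = 0.
  move=> k; case: (split_ordP k) => i ->; rewrite !labelsE => nL.
    have := Li i; have := Li' i; rewrite (negPf nL) !orbF => /eqP e' /eqP e.
    by rewrite row_mxEl mxE mxE e' [X in _ + X]mxE e subrr.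
  have := Lj i; have := Lj' i; rewrite (negPf nL) /= -hl !mulmxN.
  rewrite [X in X + _ - _]mxE => /eqP e'; rewrite [X in X + _ - _]mxE => /eqP e.
  have zA : (z^T *m A) 0 i = ((x_of w')^T *m A) 0 i - ((x_of w)^T *m A) 0 i.
    by rewrite linearB mulmxBl mxE [X in _ + X]mxE.
  have -> : c 0 (rshift m i) = (z^T *m A) 0 i + d.
    by rewrite row_mxEr mxE [X in _ + X]mxE.
  by rewrite zA /d; lra.
have cG : c *m G + d *: E = 0.
  rewrite mul_row_block scale_row_mx add_row_mx scaler0 addr0 mulmx0 addr0.
  rewrite -[0]hsubmxK linear0 linear0; congr row_mx.
    rewrite mulmxN mulmx1 opprD addrA subrr add0r.
    by apply/rowP => j; rewrite !mxE; ring.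
  apply/rowP => k; rewrite [LHS]mxE [RHS]mxE.
  have z1 : \sum_i z i 0 = 0.
    rewrite -[RHS](subrr 1) -[X in X - _]x1' -[X in _ - X]x1 -sumrB.
    by apply: eq_bigr => i _; rewrite /z mxE [X in _ + X]mxE.
  rewrite -[RHS]oppr0 -[in RHS]z1 -sumrN; apply: eq_bigr => i _.
  by rewrite [z^T _ _]mxE [X in _ * X]mxE mulrN1.
have PE u : polyhedronP A u <->
    (forall k, (G *m u) k 0 <= 0) /\ (E *m u) 0 0 = 1.
  rewrite Eu; split.
    move=> [uA u0 u1]; split=> // k; case: (split_ordP k) => i ->.
      by rewrite Gl.
    by rewrite Gr oppr_le0.
  move=> [Gu Eu1]; split=> // i; first by rewrite -Gl.
  by rewrite -oppr_le0 -Gr.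
have LE u k : (k \in labelsP A u) = ((G *m u) k 0 == 0).
  case: (split_ordP k) => i ->; rewrite !labelsE; first by rewrite Gl.
  by rewrite Gr oppr_eq0.
have [c0 d0] := nondegenerate_tight_independent PE LE nd (addn1 n) Pv cL cG.
have z0 : z = 0.
  apply/matrixP => i j; rewrite ord1 [RHS]mxE.
  have := congr1 (fun B : 'rV_ _ => B 0 (lshift n i)) c0.
  by rewrite row_mxEl !mxE.
rewrite -[w]vsubmxK -[w']vsubmxK; congr col_mx.
  by apply/eqP; rewrite eq_sym -subr_eq0; apply/eqP.
apply/matrixP => i j; rewrite ord1.
(* The two remaining coordinates are [lambda], equal by [hl], and [pi2], equal by [d0]. *)
have [->|->] : i = ord0 \/ i = ord_max; last 1 first.
- by apply/eqP; rewrite eq_sym -subr_eq0; apply/eqP.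
- by case: i => [[|[|]]] // hi; [left|right]; apply: val_inj.
exact: hl.
Qed.

(** * Injectivity of [g_sum] on [calN] *)

Lemma calN_g_sum_inj (R : realType) (m n : nat) (A : 'M[R]_(m, n)) beta
    (p q : 'cV[R]_(n + 1) * 'cV[R]_(m + 2)) :
  nondegenerate_polyhedron (polyhedronP A) (labelsP A) n ->
  nondegenerate_polyhedron (polyhedronQ' (- A) beta) (labelsQ' (- A) beta)
    m.+1 ->
  calN A (- A) beta p -> calN A (- A) beta q ->
  g_sum beta p = g_sum beta q -> p = q.
Proof.
move=> ndP ndQ Np Nq; rewrite /g_sum => gpq.
have [le0 eq0] := calN_comonotone Np Nq.
(* Equal values of [g_sum] make the two differences opposite, so their nonnegative product is minus
   a square, and both differences vanish. *)
have lam : lambda_at p = lambda_at q.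
  apply/eqP; rewrite -subr_eq0 -sqrf_eq0 eq_le sqr_ge0 andbT.
  suff -> : (lambda_at p - lambda_at q) ^+ 2 = - ((lambda_at q - lambda_at p) *
      (beta_y_at beta q - beta_y_at beta p)) by rewrite oppr_le0.
  have -> : lambda_at q - lambda_at p =
    - (beta_y_at beta q - beta_y_at beta p) by lra.
  have -> : lambda_at p - lambda_at q =
    beta_y_at beta q - beta_y_at beta p by lra.
  ring.
have bet : beta_y_at beta p = beta_y_at beta q by lra.
(* The product is zero, so the equality case puts the crossed pairs in [calN]. *)
have : `[< calN A (- A) beta (p.1, q.2) /\ calN A (- A) beta (q.1, p.2) >].
  by rewrite -eq0 lam subrr mul0r eqxx.
move=> /asboolP[Npq Nqp].
case: p q {gpq le0 eq0} Np Nq Npq Nqp lam bet => [v w] [v' w'] Np Nq Npq Nqp.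
move=> lam bet; congr pair; first exact: (calN_fst_inj ndQ Np Nqp bet).
exact: (calN_snd_inj ndP Np Npq lam).
Qed.

(** * Monotonicity along the directed path *)

Lemma g_sum_continuous (R : realType) (m n : nat) (beta : 'cV[R]_n) :
  continuous (g_sum beta : 'cV[R]_(n + 1) * 'cV[R]_(m + 2) -> R).
Proof.
move=> p; apply: cvgD.
  have -> : beta_y_at beta =
      (fun q : 'cV[R]_(n + 1) => (row_mx beta^T 0 *m q) 0 0)
      \o (@fst _ 'cV[R]_(m + 2)).
    apply/funext => q /=.
    by rewrite -[q.1 in RHS]vsubmxK mul_row_col mul0mx addr0.
  apply: continuous_comp; first exact: cvg_fst.
  exact: mulmx_coord_continuous.
have -> : @lambda_at R m n =
    (fun w : 'cV[R]_(m + 2) => w (rshift m ord0) ord0) \o snd.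
  by apply/funext => q /=; rewrite /lambda_at /lambda_of mxE.
by apply: continuous_comp; [exact: cvg_snd | exact: coord_continuous].
Qed.

Lemma beta_y_at_pure_point (R : realType) (m n : nat) (A : 'M[R]_(m, n))
    beta i j (w : 'cV[R]_(m + 2)) :
  beta_y_at beta (pure_point A i j, w) = beta j ord0.
Proof.
rewrite /beta_y_at /y_of /pure_point /= col_mxKu -colE mxE.
by rewrite mxE.
Qed.

(** A continuous injective function on the real line is strictly monotone, so comparing one point of
    each end edge settles the direction. *)
Lemma g_sum_path_increasing (R : realType) (m n : nat) (A : 'M[R]_(m, n))
    (beta : 'cV[R]_n)
    (ndP : nondegenerate_polyhedron (polyhedronP A) (labelsP A) n)
    (ndQ : nondegenerate_polyhedron (polyhedronQ' (- A) beta)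
       (labelsQ' (- A) beta) m.+1)
    (js je : 'I_n)
    (hle : beta js ord0 <= beta je ord0)
    (hse : js != je)
    (i_s i_e : 'I_m)
    (gamma : R -> 'cV[R]_(n + 1) * 'cV[R]_(m + 2)) :
  directed_path (calN A (- A) beta)
        ([set pure_point A i_s js] `*` calE A (- A) beta (pure_point A i_s js))
        ([set pure_point A i_e je] `*` calE A (- A) beta (pure_point A i_e je))
        gamma ->
  {homo (fun t : R => g_sum beta (gamma t)) : s t / s < t}.
Proof.
move=> [[gc gr [h [hK _]]] hs he].
have Ng t : calN A (- A) beta (gamma t) by rewrite -gr; exists t.
have [s [t [st [gs _] [gt _]]]] : exists s t, [/\ s < t,
    ([set pure_point A i_s js] `*` calE A (- A) beta (pure_point A i_s js))
      (gamma s) &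
    ([set pure_point A i_e je] `*` calE A (- A) beta (pure_point A i_e je))
      (gamma t)].
  near (-oo : set_system R)%R => s; near (+oo : set_system R)%R => t.
  exists s, t; split.
  - near: t; exact: nbhs_pinfty_gt.
  - by near: s.
  - by near: t.
have bs : beta_y_at beta (gamma s) = beta js ord0.
  by rewrite [gamma s]surjective_pairing gs beta_y_at_pure_point.
have bt : beta_y_at beta (gamma t) = beta je ord0.
  by rewrite [gamma t]surjective_pairing gt beta_y_at_pure_point.
have [co eqco] := calN_comonotone (Ng s) (Ng t).
(* If the two values of [beta] agreed, the comonotonicity product would vanish and a crossed pair
   would force the two end vertices to coincide, against [js != je]. *)
have blt : beta js ord0 < beta je ord0.
  rewrite lt_neqAle hle andbT; apply/eqP => bse.
  have : `[< calN A (- A) beta ((gamma s).1, (gamma t).2) /\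
             calN A (- A) beta ((gamma t).1, (gamma s).2) >].
    by rewrite -eqco bs bt bse subrr mulr0 eqxx.
  move=> /asboolP[_ Nts].
  have : (gamma s).1 = (gamma t).1.
    apply: (calN_fst_inj ndQ _ Nts); rewrite -surjective_pairing //.
    by rewrite bs bse -bt.
  rewrite gs gt => /eq_col_mx[/matrixP/(_ js ord0)].
  rewrite !mxE !eqxx (negPf hse) => /eqP.
  by rewrite oner_eq0.
(* As [beta^T y] is strictly larger at [t], comonotonicity makes [lambda] at least as large
   there. *)
have gst : g_sum beta (gamma s) <= g_sum beta (gamma t).
  move: co; rewrite bs bt pmulr_lge0 ?subr_gt0// subr_ge0 => lst.
  by rewrite /g_sum bs bt lerD// ltW.
have ginj : {in `]-oo, +oo[ &, injective (fun t : R => g_sum beta (gamma t))}.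
  move=> a b _ _ /(calN_g_sum_inj ndP ndQ (Ng a) (Ng b)) /(congr1 h).
  by rewrite !hK.
have gcont : continuous (fun t : R => g_sum beta (gamma t)).
  by move=> a; apply: continuous_comp; [exact: gc|exact: g_sum_continuous].
have inc := @itv_continuous_inj_le R (fun t : R => g_sum beta (gamma t))
  `]-oo, +oo[ _ (continuous_subspaceT gcont) ginj.
have {}inc : {mono (fun t : R => g_sum beta (gamma t)) : a b / a <= b}.
  by move=> a b; apply: inc; rewrite ?in_itv//; exists s, t; split;
    rewrite ?in_itv.
by move=> a b; rewrite (leW_mono inc).
Unshelve. all: by end_near.
Qed.

Theorem lemma17 (R : realType) (m n : nat) (A C : 'M[R]_(m, n))
    (beta : 'cV[R]_n) (hA : A != 0) (hbeta : beta != 0) (hC : C = - A)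
    (ndP : nondegenerate_polyhedron (polyhedronP A) (labelsP A) n)
    (ndQ : nondegenerate_polyhedron (polyhedronQ' C beta) (labelsQ' C beta) m.+1)
    (js je : 'I_n)
    (hjs : forall j : 'I_n, beta js ord0 <= beta j ord0)
    (hje : forall j : 'I_n, beta j ord0 <= beta je ord0)
    (hse : js != je)
    (i_s i_e : 'I_m)
    (his : forall i : 'I_m, A i js <= A i_s js)
    (hie : forall i : 'I_m, A i je <= A i_e je)
    (gamma : R -> 'cV[R]_(n + 1) * 'cV[R]_(m + 2))
    (hgamma :
      let vs := pure_point A i_s js in
      let ve := pure_point A i_e je in
      directed_path (calN A C beta)
        ([set vs] `*` calE A C beta vs) ([set ve] `*` calE A C beta ve)
        gamma) :
  [/\ {homo (fun t : R => beta_y_at beta (gamma t)) : s t / s <= t},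
      {homo (fun t : R => lambda_at (gamma t)) : s t / s <= t}
    & {homo (fun t : R => g_sum beta (gamma t)) : s t / s < t}].
Proof.
subst C.
have gmono := g_sum_path_increasing ndP ndQ (hjs je) hse hgamma.
have [[_ gr _] _ _] := hgamma.
have Ng t : calN A (- A) beta (gamma t) by rewrite -gr; exists t.
(* If one term dropped while [g_sum] rose, the other would have to rise strictly, and the product of
   the two differences would be negative. *)
have both s t : s <= t -> beta_y_at beta (gamma s) <= beta_y_at beta (gamma t)
    /\ lambda_at (gamma s) <= lambda_at (gamma t).
  rewrite le_eqVlt => /predU1P[->//|/gmono].
  have [co _] := calN_comonotone (Ng s) (Ng t).
  rewrite /g_sum => gst; split; rewrite leNgt; apply/negP => lt_ts.
    by move: co; rewrite nmulr_lge0; [lra|rewrite subr_lt0].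
  by move: co; rewrite nmulr_rge0; [lra|rewrite subr_lt0].
by split=> [s t /both[]|s t /both[]|].
Qed.
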